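(* Let $(W,S)$ be a (not necessarily finite) Coxeter system whose Coxeter diagram is acyclic (contains no cycles), and let $w \in W$ be a non-identity fully commutative element. For the convex set $C=[\mathrm{id},w]_L$ we have $$b(C)\geq \frac{1}{3}.$$
   Context: Let $(W,S)$ be a Coxeter system, with $m_{ij}$ the order of $s_is_j$ for $s_i,s_j\in S$. Its Coxeter diagram is the graph with vertex set $S$ and an edge labelled $m_{ij}$ between $s_i$ and $s_j$ whenever $m_{ij}\ge 3$ (including $m_{ij}=\infty$). For $w\in W$, $\ell(w)$ is the Coxeter length, and a reduced word for $w$ is an expression of $w$ as a product of $\ell(w)$ elements of $S$. The left weak order $\le_L$ on $W$ is the partial order with cover relations $u \lessdot_L su$ whenever $s\in S$ and $\ell(su)=\ell(u)+1$; $[\mathrm{id},w]_L=\{u\in W : u\le_L w\}$. An element $w$ is fully commutative if all reduced words of $w$ are connected to each other by commutation moves, i.e. by replacing consecutive letters $s_is_j$ with $s_js_i$ when $m_{ij}=2$. Equivalently, no reduced word of $w$ contains a consecutive factor $s_is_js_i\cdots$ of alternating letters of length $m_{ij}$ with $3\le m_{ij}<\infty$. The set of reflections $T$ is the set of $W$-conjugates of elements of $S$. A subset $C\subseteq W$ is (left) convex if whenever $u,v\in C$, all elements on minimum-length paths between $u$ and $v$ in the left Cayley graph (the undirected graph on $W$ with edges $u - su$, $s\in S$) lie in $C$; the interval $[\mathrm{id},w]_L$ is convex. For a finite nonempty convex set $C$ and $t\in T$, let $C_t=\{u\in C : \ell(ut)<\ell(u)\}$ and $\delta_C(t)=|C_t|/|C|$.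 The balance constant is $b(C)=\max_{t\in T}\min(\delta_C(t),1-\delta_C(t))$. *)

(* Defs.v *)
From Stdlib Require Export Relation_Operators.
From mathcomp Require Export all_boot all_order all_algebra finmap.
From mathcomp Require Export boolp classical_sets cardinality.

Set Implicit Arguments.
Unset Strict Implicit.
Unset Printing Implicit Defensive.

Import Order.TTheory GRing.Theory Num.Theory.

Local Open Scope classical_set_scope.
Local Open Scope group_scope.

(* [x0] is only returned when [A] has no least (resp. greatest) element. *)
Definition minimum d (T : porderType d) (x0 : T) (A : set T) : T :=
  xget x0 (A `&` lbound A).
Definition maximum d (T : porderType d) (x0 : T) (A : set T) : T :=
  xget x0 (A `&` ubound A).

(* The value 0 encodes infinite order. *)
Definition elt_order (W : groupType) (x : W) : nat :=
  minimum 0%N [set n | (0 < n)%N /\ x ^+ n = 1].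

Definition word_in (W : groupType) (S : set W) (u : seq W) : Prop :=
  {in u, forall s, S s}.

Definition word_prod (W : groupType) (u : seq W) : W := \prod_(s <- u) s.

(* Insertion of a defining relator (s t)^m, where m is the order of s t.  When
   that order is infinite, the inserted word is empty: there is no relator. *)
Definition insert_relator (W : groupType) (S : set W) (u v : seq W) : Prop :=
  exists a b s t, [/\ S s, S t, u = a ++ b &
    v = a ++ flatten (nseq (elt_order (s * t)) [:: s; t]) ++ b].

(* (W, S) is a Coxeter system: S generates W, its elements have order 2, and
   <S | (s t)^m(s,t) = 1 for m(s,t) finite> is a presentation of W, m(s,t)
   being the order of s t.  The relators s^2 (case t = s) make inverses
   superfluous, so the presentation is expressed on words over S: two of them
   have the same value in W exactly when they are related by insertions and
   deletions of relators (the converse implication is automatic). *)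
Record coxeter_system (W : groupType) (S : set W) : Prop := CoxeterSystem {
  coxeter_order2 : forall s, S s -> elt_order s = 2%N ;
  coxeter_generated : forall w, exists2 u, word_in S u & word_prod u = w ;
  coxeter_presentation : forall u v, word_in S u -> word_in S v ->
    word_prod u = word_prod v -> clos_refl_sym_trans _ (insert_relator S) u v
}.

(* The disjunct m(s,t) = 0 is the label infinity. *)
Definition diagram_edge (W : groupType) (S : set W) : rel W :=
  fun s t => `[< [/\ S s, S t, s <> t &
    elt_order (s * t) = 0%N \/ (3 <= elt_order (s * t))%N] >].

Definition acyclic_diagram (W : groupType) (S : set W) : Prop :=
  forall c : seq W, (3 <= size c)%N -> ~ ucycle (diagram_edge S) c.

Definition word_for (W : groupType) (S : set W) (w : W) (u : seq W) : Prop :=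
  word_in S u /\ word_prod u = w.

Definition cox_length (W : groupType) (S : set W) (w : W) : nat :=
  minimum 0%N [set size u | u in word_for S w].

Definition reduced_word (W : groupType) (S : set W) (w : W) (u : seq W) : Prop :=
  word_for S w u /\ size u = cox_length S w.

Definition commutation_move (W : groupType) (u v : seq W) : Prop :=
  exists a b s t, [/\ elt_order (s * t) = 2%N,
    u = a ++ [:: s; t] ++ b & v = a ++ [:: t; s] ++ b].

Definition fully_commutative (W : groupType) (S : set W) (w : W) : Prop :=
  forall u v, reduced_word S w u -> reduced_word S w v ->
    clos_refl_sym_trans _ (@commutation_move W) u v.

Definition weak_cover (W : groupType) (S : set W) (u v : W) : Prop :=
  exists2 s, S s & v = s * u /\ cox_length S v = (cox_length S u).+1.

Definition left_weak_le (W : groupType) (S : set W) : W -> W -> Prop :=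
  clos_refl_trans _ (weak_cover S).

(* The interval [id, w]_L; id is the minimum of the left weak order, but the
   lower bound is kept. *)
Definition weak_interval (W : groupType) (S : set W) (w : W) : set W :=
  [set u | left_weak_le S 1 u /\ left_weak_le S u w].

Definition reflections (W : groupType) (S : set W) : set W :=
  [set s ^ g | s in S & g in [set: W]].

Definition inversion_part (W : groupType) (S : set W) (C : set W) (t : W) :
    set W :=
  [set u | C u /\ (cox_length S (u * t) < cox_length S u)%N].

(* Meaningful for finite nonempty C: [fset_set] is empty on infinite sets. *)
Definition inversion_ratio (W : groupType) (S : set W) (C : set W) (t : W) :
    rat :=
  (#|` fset_set (inversion_part S C t)|%:R / #|` fset_set C|%:R)%R.

(* For finite C the ratios take finitely many values, so that the greatest
   element exists as soon as S, hence the set of reflections, is nonempty. *)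
Definition balance_constant (W : groupType) (S : set W) (C : set W) : rat :=
  maximum 0%R [set Order.min (inversion_ratio S C t)
                             (1 - inversion_ratio S C t)%R
              | t in reflections S].

(* Main.v *)
(* Read a reduced word of [w] as a heap: a finite poset labelled by [S], in which
   two letters are comparable as soon as their labels are equal or adjacent in
   the diagram.  As [w] is fully commutative, [id, w]_L is the set of values of
   the subwords carried by the upsets of the heap, and every letter [x] gives a
   reflection which is an inversion of such a value exactly when the upset
   contains [x].  So some letter must lie in a proportion of the upsets between
   1/3 and 2/3.

   Otherwise the letters lying in more than 2/3 of the upsets form an upset [A].
   Call a neighbour [r] of [s] active for [s] when some letter labelled [r]
   separates the letters [s] outside [A] from those in [A].  Every label [s] has
   an active neighbour: otherwise a letter [s] could be freely removed from, or
   added to, every upset, or two consecutive letters [s] would cancel in the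
   word.  If [s] is active for [t], counting upsets shows that some [r] distinct
   from [t] is active for [s].  This yields an infinite walk without
   backtracking in the diagram, which is impossible in a finite forest. *)
Require Import Defs.
From mathcomp Require Import zify lra.
Set Implicit Arguments.
Unset Strict Implicit.
Unset Printing Implicit Defensive.
Import Order.TTheory GRing.Theory Num.Theory.

(** * Upsets of a finite labelled linear order *)

Section Upsets.
Import mathcomp.boot.fintype mathcomp.boot.finset.
Variables (X : finType) (T : eqType) (f : X -> T) (e : rel T).
Hypotheses (e_sym : symmetric e) (e_irr : irreflexive e).

Definition linked (p q : T) := (p == q) || e p q.

Lemma linkedC p q : linked p q = linked q p.
Proof. by rewrite /linked eq_sym e_sym. Qed.

(** Closure under the relations that generate the heap order suffices, so their transitive closure
    is never formed. *)
Definition upset (pos : X -> nat) : {set {set X}} :=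
  [set I : {set X} | [forall x in I, forall y,
     (pos x < pos y) && linked (f x) (f y) ==> (y \in I)]].

Lemma upsetP pos (I : {set X}) :
  reflect (forall x y, x \in I -> pos x < pos y -> linked (f x) (f y) -> y \in I)
          (I \in upset pos).
Proof.
rewrite inE; apply: (iffP forall_inP) => [h x y xI xy l | h x xI].
  by move: (forallP (h x xI) y); rewrite xy l.
by apply/forallP => y; apply/implyP => /andP[xy l]; apply: h xI xy l.
Qed.

Definition upsets_with pos x : {set {set X}} := [set I in upset pos | x \in I].

Lemma upsets_withE pos x I :
  (I \in upsets_with pos x) = (I \in upset pos) && (x \in I).
Proof. by rewrite in_set. Qed.

(* Under the assumption that no element is balanced, [A] separates the elements
   lying in more than two thirds of the upsets from those lying in less than a
   third of them. *)
Definition cut pos (A : {set X}) := forall x,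
  if x \in A then 2 * #|upset pos| < 3 * #|upsets_with pos x|
  else 3 * #|upsets_with pos x| < #|upset pos|.

Definition active pos (A : {set X}) s r := exists z,
  [/\ f z = r, e s r & forall x, f x = s ->
      if x \in A then pos z < pos x else pos x < pos z].

Lemma upset_dual pos pos' (I : {set X}) :
    (forall x y, (pos' x < pos' y) = (pos y < pos x)) ->
  (~: I \in upset pos') = (I \in upset pos).
Proof.
move=> posE; apply/upsetP/upsetP => h x y.
  move=> xI xy l; apply: contraLR xI; rewrite -!in_setC => yI.
  by apply: (h y x yI); rewrite ?posE 1?linkedC.
rewrite !inE => xI; rewrite posE linkedC => xy l.
by apply: contra xI => yI; apply: (h y).
Qed.

(** Complements of the upsets avoiding [x] are the upsets of the reversed order containing [x],
    which exchanges the thresholds 1/3 and 2/3. *)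
Lemma cut_dual pos pos' A :
    (forall x y, (pos' x < pos' y) = (pos y < pos x)) ->
  cut pos A -> cut pos' (~: A).
Proof.
move=> posE cA x.
have -> : #|upset pos'| = #|upset pos|.
  rewrite -(card_imset _ (@setC_inj X)); apply: eq_card => I.
  apply/imsetP/idP => [[J h ->]|h]; first by rewrite -(upset_dual _ posE) setCK.
  by exists (~: I); rewrite ?setCK // (upset_dual _ posE).
have : #|upsets_with pos x| + #|upsets_with pos' x| = #|upset pos|.
  rewrite -(cardsID [set I : {set X} | x \in I] (upset pos)); congr (_ + _).
    by apply: eq_card => I; rewrite upsets_withE in_setI; congr (_ && _); rewrite in_set.
  rewrite -(card_imset (_ :\: _) (@setC_inj X)); apply: eq_card => I.
  apply/idP/imsetP => [|[J]].
    rewrite in_set => /andP[h xI]; exists (~: I); rewrite ?setCK //.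
    by rewrite in_setD in_set in_setC xI -(upset_dual _ posE) setCK h.
  rewrite in_setD in_set => /andP[xJ h] ->.
  by rewrite in_set (upset_dual _ posE) h in_setC.
by move: (cA x); rewrite inE; case: (x \in A) => /=; lia.
Qed.

Lemma active_dual pos pos' A s r :
    (forall x y, (pos' x < pos' y) = (pos y < pos x)) ->
  active pos' (~: A) s r -> active pos A s r.
Proof.
move=> posE [z [fz er h]]; exists z; split=> // x /h.
by rewrite inE !posE; case: (x \in A).
Qed.

Lemma dual_pos pos : injective pos -> exists2 pos' : X -> nat,
  injective pos' & forall x y, (pos' x < pos' y) = (pos y < pos x).
Proof.
move=> pos_inj; have [M leM] : exists M, forall x, pos x <= M.
  by exists (\max_y pos y) => x; apply: leq_bigmax.
exists (fun x => M - pos x) => x y; last exact: ltn_sub2lE.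
by move: (leM x) (leM y) => lx ly exy; apply: pos_inj; lia.
Qed.

(** * Counting upsets on one side of a cut *)

Section Cut.
Variables (pos : X -> nat) (A : {set X}).
Hypotheses (pos_inj : injective pos) (cA : cut pos A).

(** An upset containing [x] contains every [y] above [x], so the share of [y] also exceeds 2/3 and
    cannot be below 1/3. *)
Lemma cut_upset : A \in upset pos.
Proof.
apply/upsetP => x y xA xy l.
have le_xy : #|upsets_with pos x| <= #|upsets_with pos y|.
  apply: subset_leq_card; apply/subsetP => I; rewrite !upsets_withE.
  by case/andP=> h xI; rewrite h (upsetP _ _ h x).
by move: (cA x) (cA y); rewrite xA; case: (y \in A) => //; lia.
Qed.

Lemma leq_card_add (Q : {set {set X}}) x :
    (forall I, I \in Q -> x \notin I /\ x |: I \in upset pos) ->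
  #|Q| <= #|upsets_with pos x|.
Proof.
move=> h; have inj : {in Q &, injective (fun I => x |: I)}.
  move=> I J /h[xI _] /h[xJ _] eIJ.
  by rewrite -(setU1K xI) -(setU1K xJ) eIJ.
rewrite -(card_in_imset inj); apply: subset_leq_card; apply/subsetP => J.
by case/imsetP=> I /h[_ hI] ->; rewrite in_set hI setU11.
Qed.

(* Otherwise the last letter labelled [s] outside [A] could be added to every
   upset agreeing with [A] on the letters labelled [s] or [t], and these form
   more than a third of all upsets. *)
Lemma active_step_notin t s z :
    f z = s -> e t s -> z \notin A ->
    (forall x, f x = t -> if x \in A then pos z < pos x else pos x < pos z) ->
  exists2 r, r != t & active pos A s r.
Proof.
move=> fz ets zA hz; apply: contrapT => no.
pose P := [pred y | (f y == s) && (y \notin A)].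
have Pz : P z by rewrite /= fz eqxx.
case: (arg_maxnP pos Pz) => x /andP[/eqP fx xA] xmax.
(* [x] can replace [z]: a letter [t] outside [A] precedes [z], hence [x], and one in [A] before [x]
   would force [x] into [A]. *)
have tz y : f y = t -> if y \in A then pos x < pos y else pos y < pos x.
  move=> fy; move: (hz y fy); case: ifP => [yA|yA] h; last first.
    by apply: leq_trans h (xmax z Pz).
  rewrite ltnNge; apply: contra xA; rewrite leq_eqVlt => /orP[/eqP/pos_inj xy|xy].
    by rewrite -xy.
  by apply: (upsetP _ _ cut_upset y); rewrite // /linked fy fx ets orbT.
(* As [s] and [t] are adjacent, [D] is a chain of the heap, and [x] is its last letter outside
   [A]. *)
pose D := [set y : X | (f y == s) || (f y == t)].
pose Q : {set {set X}} := [set I in upset pos | I :&: D == A :&: D].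
have memQ I y : I \in Q -> y \in D -> (y \in I) = (y \in A).
  rewrite in_set => /andP[_ /eqP/setP/(_ y)]; rewrite !in_setI => + yD.
  by rewrite yD !andbT.
have sD y : f y = s -> y \in D by move=> fy; rewrite inE fy eqxx.
have tD y : f y = t -> y \in D by move=> fy; rewrite inE fy eqxx orbT.
have lnk y y' : y \in D -> y' \in D -> linked (f y) (f y').
  rewrite !inE /linked => /orP[]/eqP-> /orP[]/eqP->; rewrite ?eqxx //.
    by rewrite e_sym ets orbT.
  by rewrite ets orbT.
have xD := sD x fx.
have leQ : #|Q| <= #|upsets_with pos x|.
  apply: leq_card_add => I IQ; rewrite (memQ I x IQ xD); split => //.
  have IU : I \in upset pos by move: IQ; rewrite in_set => /andP[].
  apply/upsetP => i j /setU1P[->|iI] ij l; last first.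
    by rewrite in_setU1 (upsetP _ _ IU i) ?orbT.
  rewrite in_setU1; apply/orP; right.
  have [jt|jt] := eqVneq (f j) t.
    rewrite (memQ I j IQ (tD j jt)).
    by move: (tz j jt); case: ifP => //; lia.
  have [js|js] := eqVneq (f j) s.
    rewrite (memQ I j IQ (sD j js)); apply: contraLR ij => jA.
    by rewrite -leqNgt; apply: xmax; rewrite /= js eqxx.
  (* Such a [j] separates the letters [s]: those outside [A] come no later than [x], and one in [A]
     before [j] would put [j] in [I]. *)
  apply: contrapT => jI; apply: no; exists (f j) => //.
  have esj : e s (f j) by move: l; rewrite /linked fx eq_sym (negPf js).
  exists j; split => // y fy; case: ifP => yA; last first.
    by apply: leq_ltn_trans ij; apply: xmax; rewrite /= fy eqxx yA.
  rewrite ltnNge leq_eqVlt; apply/negP => /orP[/eqP/pos_inj yj|yj].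
    by move: js; rewrite -yj fy eqxx.
  apply: jI; apply: (upsetP _ _ IU y) => //; last by rewrite /linked fy esj orbT.
  by rewrite (memQ I y IQ (sD y fy)).
(* An upset that meets [D] outside [A] contains [x], the last such letter. *)
have notQ I : I \in upset pos -> I \notin Q -> x \notin I ->
    exists2 y, y \in A :&: D & y \notin I.
  move=> IU IQ xI; apply: contrapT => none; move/negP: IQ; apply.
  rewrite in_set IU; apply/eqP/setP => y; rewrite !in_setI.
  case yD: (y \in D); rewrite ?andbT ?andbF //; apply/idP/idP => [yI|yA].
    apply: contrapT => /negP yA; move/negP: xI; apply.
    have [->//|nxy] := eqVneq x y.
    apply: (upsetP _ _ IU y) => //; last exact: lnk.
    move: (yD); rewrite inE => /orP[]/eqP fy; last first.
      by move: (tz y fy); rewrite (negPf yA).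
    have := xmax y; rewrite /= fy eqxx yA => /(_ isT); rewrite leq_eqVlt.
    by case/orP => // /eqP /pos_inj yx; rewrite yx eqxx in nxy.
  apply: contrapT => /negP yI; apply: none; exists y => //.
  by rewrite in_setI yA.
have cx : 3 * #|upsets_with pos x| < #|upset pos|.
  by move: (cA x); rewrite (negPf xA).
have [AD0|/set0Pn[y0 y0AD]] := eqVneq (A :&: D) set0.
  suff : #|upset pos| <= #|Q| + #|upsets_with pos x| by lia.
  apply: leq_trans (leq_card_setU _ _); apply: subset_leq_card.
  apply/subsetP => I IU; rewrite in_setU upsets_withE IU /=.
  apply: contrapT => /negP; rewrite negb_or => /andP[IQ xI].
  by have [y] := notQ I IU IQ xI; rewrite AD0 inE.
(* An upset containing the first letter [y] of [A :&: D] contains all of it, so it is in [Q] or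
   contains [x]: more than 2/3 of the upsets would be covered by two families of less than 1/3
   each. *)
case: (@arg_minnP _ y0 [in A :&: D] pos y0AD) => y yAD ymin.
have cy : 2 * #|upset pos| < 3 * #|upsets_with pos y|.
  by move: (cA y) yAD; rewrite in_setI; case: (y \in A).
suff : #|upsets_with pos y| <= #|Q| + #|upsets_with pos x| by lia.
apply: leq_trans (leq_card_setU _ _); apply: subset_leq_card.
apply/subsetP => I; rewrite in_setU !upsets_withE => /andP[IU yI].
rewrite IU /=; apply: contrapT => /negP; rewrite negb_or => /andP[IQ xI].
have [y' y'AD y'I] := notQ I IU IQ xI.
move/negP: y'I; apply; have := ymin y' y'AD; rewrite leq_eqVlt.
case/orP => [/eqP/pos_inj <- //|yy']; apply: (upsetP _ _ IU y) => //.
by apply: lnk; move: yAD y'AD; rewrite !in_setI => /andP[_ ?] /andP[_ ?].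
Qed.

(** Without an active neighbour, no letter linked to the last letter labelled [f x0] comes after it.
    That letter could then be added to any upset, so it would lie in at least half of them. *)
Lemma active_start_notin x0 :
    (forall x, f x = f x0 -> x \notin A) -> exists r, active pos A (f x0) r.
Proof.
move=> sA; apply: contrapT => no.
case: (@arg_maxnP _ x0 [pred x | f x == f x0] pos (eqxx _)) => x /eqP fx xmax.
suff : #|upset pos :\: upsets_with pos x| <= #|upsets_with pos x|.
  have xA := sA x fx; move: (cA x); rewrite (negPf xA) => cx.
  have /setIidPr : upsets_with pos x \subset upset pos.
    by apply/subsetP => I; rewrite upsets_withE => /andP[].
  by move=> IE; move: (cardsID (upsets_with pos x) (upset pos)); rewrite IE; lia.
apply: leq_card_add => I; rewrite in_setD upsets_withE => /andP[+ IU].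
rewrite IU /= => xI; split => //; apply/upsetP => i j /setU1P[->|iI] ij l.
  case: no; have fj : f j <> f x0.
    move=> fj; move: ij; rewrite ltnNge => /negP; apply.
    by apply: xmax; rewrite /= fj eqxx.
  exists (f j), j; split => //.
    by move: l; rewrite /linked fx eq_sym; move/eqP/negPf: fj => ->.
  move=> y fy; rewrite (negPf (sA y fy)); apply: leq_ltn_trans ij.
  by apply: xmax; rewrite /= fy eqxx.
by rewrite in_setU1 (upsetP _ _ IU i) ?orbT.
Qed.

End Cut.

(** * Walks along active neighbours *)

Section Walk.
Variables (pos : X -> nat) (A : {set X}).
Hypotheses (pos_inj : injective pos) (cA : cut pos A).
Hypothesis sep : forall x y, pos x < pos y -> f x = f y ->
  exists2 z, pos x < pos z < pos y & e (f x) (f z).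

Lemma active_step t s : active pos A t s -> exists2 r, r != t & active pos A s r.
Proof.
have [dpos dpos_inj dposE] := dual_pos pos_inj.
move=> [z [fz ets hz]]; have [zA|zA] := boolP (z \in A); last first.
  exact: active_step_notin hz.
(* When [z] is in [A], reverse the order and complement [A]. *)
have [|x /hz|r rt /(active_dual dposE) h] :=
    @active_step_notin _ _ dpos_inj (cut_dual dposE cA) t s z fz ets.
- by rewrite inE zA.
- by rewrite inE !dposE; case: (x \in A).
by exists r.
Qed.

(** If the label [f x0] occurs on both sides of the cut, [sep] gives a letter between its last
    occurrence outside [A] and its first one inside; otherwise the one-sided case or its dual
    applies. *)
Lemma active_start x0 : exists r, active pos A (f x0) r.
Proof.
have [dpos dpos_inj dposE] := dual_pos pos_inj.
pose PA := [pred x | (f x == f x0) && (x \in A)].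
pose PB := [pred x | (f x == f x0) && (x \notin A)].
have [/existsP[xA hA]|/existsPn noA] := boolP [exists x, PA x]; last first.
  apply: active_start_notin => // x fx.
  by move: (noA x); rewrite /= fx eqxx.
have [/existsP[xB hB]|/existsPn noB] := boolP [exists x, PB x]; last first.
  have [x fx|r /(active_dual dposE) h] :=
      @active_start_notin _ _ (cut_dual dposE cA) x0; last by exists r.
  by move: (noB x); rewrite /= fx eqxx inE.
case: (arg_minnP pos hA) => y /andP[/eqP fy yA] ymin.
case: (arg_maxnP pos hB) => x /andP[/eqP fx xB'] xmax.
have xy : pos x < pos y.
  rewrite ltnNge leq_eqVlt; apply/negP => /orP[/eqP/pos_inj yx|yx].
    by rewrite -yx yA in xB'.
  move/negP: xB'; apply; apply: (upsetP _ _ (cut_upset cA) y) => //.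
  by rewrite /linked fx fy eqxx.
have [|z /andP[xz zy] ez] := sep xy; first by rewrite fx fy.
exists (f z), z; split => //; first by rewrite -fx.
move=> u fu; case: ifP => uA.
  by apply: leq_trans zy _; apply: ymin; rewrite /= fu eqxx uA.
by apply: leq_ltn_trans xz; apply: xmax; rewrite /= fu eqxx uA.
Qed.

Lemma cut_cycle (x0 : X) : exists2 c, 2 < size c & ucycle e c.
Proof.
apply: contrapT => acyc.
have walk k : exists s t q, [/\ uniq (s :: t :: q), path e s (t :: q),
    active pos A t s, size q = k & {subset s :: t :: q <= codom f}].
  elim: k => [|k [s [t [q [uq pq act sq sub]]]]].
    have [r actr] := active_start x0; case: (actr) => z [fz er _].
    exists r, (f x0), [::]; split => //.
    - rewrite /= inE !andbT; apply/eqP => rx0.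
      by rewrite rx0 e_irr in er.
    - by rewrite /= e_sym er.
    - move=> y; rewrite !inE => /orP[]/eqP ->; last exact: codom_f.
      by rewrite -fz codom_f.
  have [r rt actr] := active_step act; case: (actr) => z [fz er _].
  have rs : r != s by apply/eqP => rs; rewrite rs e_irr in er.
  exists r, s, (t :: q); split => //.
  - rewrite cons_uniq uq andbT !in_cons (negPf rs) (negPf rt) /=.
    (* The walk is listed from its newest label. If [r] was visited before, the part from [s] back
       to [r] closes up into a cycle, of length at least 3 since it passes through [t]. *)
    apply/negP => rq; apply: acyc; case/splitPr: rq uq pq {sq sub} => q1 q2 uq pq.
    exists (s :: t :: rcons q1 r); first by rewrite /= size_rcons.
    apply/andP; split.
      rewrite /= rcons_path last_rcons [e r s]e_sym er andbT.
      move: pq; rewrite -cat_rcons /= cat_path.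
      by case/and3P => -> ->.
    move: uq; rewrite -cat_rcons -!cat_cons cat_uniq.
    by case/andP.
  - by rewrite /= e_sym er.
  - by rewrite /= sq.
  - move=> y; rewrite in_cons => /orP[/eqP ->|/sub //].
    by rewrite -fz codom_f.
(* [#|X| + 2] distinct labels cannot all be values of [f]. *)
have [s [t [q [uq _ _ sq sub]]]] := walk #|X|.
by have := uniq_leq_size uq sub; rewrite /= size_codom sq; lia.
Qed.

End Walk.

Theorem balanced_element (pos : X -> nat) (x0 : X) :
    injective pos ->
    (forall x y, pos x < pos y -> f x = f y ->
       exists2 z, pos x < pos z < pos y & e (f x) (f z)) ->
    (forall c, 2 < size c -> ~ ucycle e c) ->
  exists x, #|upset pos| <= 3 * #|upsets_with pos x| <= 2 * #|upset pos|.
Proof.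
move=> pos_inj sep acyc; apply: contrapT => no.
pose A := [set x : X | 2 * #|upset pos| < 3 * #|upsets_with pos x|].
have cA : cut pos A.
  move=> x; rewrite inE; case: ltnP => // le2; rewrite ltnNge.
  by apply/negP => le1; apply: no; exists x; rewrite le1 le2.
by have [c c3 /(acyc c c3)] := cut_cycle pos_inj cA sep x0.
Qed.

End Upsets.

Local Open Scope classical_set_scope.
Local Open Scope group_scope.

(** * Reflections of words *)

Lemma minimum_natP (A : set nat) n : A n ->
  A (minimum 0%N A) /\ forall k, A k -> (minimum 0%N A <= k)%N.
Proof.
move=> An; have exA : exists k, `[< A k >] by exists n; apply/asboolP.
rewrite /minimum; case: xgetP => [_ -> [Am lbm]|no]; first by split.
case: (ex_minnP exA) => m /asboolP Am mmin; case: (no m); split => // k /asboolP.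
exact: mmin.
Qed.

Section Words.
Variable W : groupType.
Implicit Types (u v a b : seq W) (x y s t : W).

Lemma elt_orderP x : (0 < elt_order x)%N -> x ^+ elt_order x = 1.
Proof.
rewrite /elt_order /minimum; case: xgetP => [_ -> [[_ ->]] //|_].
by rewrite ltnn.
Qed.

Lemma elt_order_gt0 x n : (0 < n)%N -> x ^+ n = 1 -> (0 < elt_order x <= n)%N.
Proof.
by move=> n0 xn; have [[-> _] ->] := @minimum_natP
  [set n | (0 < n)%N /\ x ^+ n = 1] n (conj n0 xn).
Qed.

Lemma word_prod_nil : word_prod [::] = 1 :> W.
Proof. exact: big_nil. Qed.

Lemma word_prod_cons x u : word_prod (x :: u) = x * word_prod u.
Proof. exact: big_cons. Qed.

Lemma word_prod_cat u v : word_prod (u ++ v) = word_prod u * word_prod v.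
Proof. exact: big_cat. Qed.

Lemma word_prod_relator n s t :
  word_prod (flatten (nseq n [:: s; t])) = (s * t) ^+ n.
Proof.
elim: n => [|n IH]; first exact: word_prod_nil.
by rewrite /= !word_prod_cons IH mulgA expgS.
Qed.

(* If [u = s_1 ... s_k], these are the reflections
   [s_k ... s_(i+1) s_i s_(i+1) ... s_k]. *)
Fixpoint refls u : seq W :=
  if u is s :: v then s ^ word_prod v :: refls v else [::].

Lemma refls_cat u v :
  refls (u ++ v) = [seq t ^ word_prod v | t <- refls u] ++ refls v.
Proof. by elim: u => //= s u ->; rewrite word_prod_cat conjgM. Qed.

(* The powers of [t * s] run twice through a period when [m] is the order of
   [s * t], so every reflection occurs an even number of times in a relator. *)
Lemma refls_relator m s t : s * s = 1 -> t * t = 1 ->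
  refls (flatten (nseq m [:: s; t])) =
  rev (mkseq (fun k => (t * s) ^+ k * t) (m + m)).
Proof.
move=> ss tt; have sV : s^-1 = s by rewrite -[RHS](mulKg s) ss mulg1.
have tV : t^-1 = t by rewrite -[RHS](mulKg t) tt mulg1.
have conjE k n : ((t * s) ^+ k * t) ^ ((s * t) ^+ n) = (t * s) ^+ (n + n + k) * t.
  elim: n => [|n IH]; first by rewrite conjg1.
  rewrite expgSr conjgM IH addSn addnS addSn addSn expgS expgSr.
  by rewrite /conjg invgM sV tV !mulgA.
elim: m => [//|m IH].
rewrite addSn addnS /mkseq -addn2 iotaD map_cat rev_cat -IH /= add0n.
rewrite word_prod_cons word_prod_relator conjgM.
have -> : s ^ t = (t * s) ^+ 1 * t by rewrite /conjg tV mulgA.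
by rewrite conjE -[X in X ^ _]mul1g -[1](expg0 (t * s)) conjE addn1 addn0.
Qed.

Lemma count_conj x g u :
  count_mem x [seq t ^ g | t <- u] = count_mem (x ^ g^-1) u.
Proof.
rewrite count_map; apply: eq_count => t /=.
by apply/eqP/eqP => [<-|->]; rewrite ?conjgK ?conjgKV.
Qed.

(** A relator has value 1, so the letters before it keep their reflections, and its own reflections
    each occur an even number of times. *)
Lemma count_refls_insert S u v x : (forall s, S s -> s * s = 1) ->
  insert_relator S u v -> odd (count_mem x (refls u)) = odd (count_mem x (refls v)).
Proof.
move=> S2 [a [b [s [t [Ss St -> ->]]]]]; set r := flatten _.
have r1 : word_prod r = 1.
  rewrite /r word_prod_relator.
  by case: (posnP (elt_order (s * t))) => [->//|/elt_orderP].
have cr y : ~~ odd (count_mem y (refls r)).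
  rewrite /r; have [-> //|m0] := posnP (elt_order (s * t)).
  rewrite refls_relator ?S2 // count_rev /mkseq iotaD map_cat count_cat.
  suff -> : [seq (t * s) ^+ k * t | k <- iota (0 + elt_order (s * t)) (elt_order (s * t))]
          = [seq (t * s) ^+ k * t | k <- iota 0 (elt_order (s * t))].
    by rewrite addnn odd_double.
  rewrite add0n -[X in iota X _]addn0 iotaDl -map_comp; apply: eq_map => k /=.
  rewrite expgnDr; suff -> : (t * s) ^+ elt_order (s * t) = 1 by rewrite mul1g.
  have -> : t * s = (s * t) ^ s by rewrite /conjg !mulgA mulVg mul1g.
  by rewrite -conjXg elt_orderP // conj1g.
rewrite !refls_cat !count_cat word_prod_cat r1 mul1g !oddD count_conj.
by rewrite [X in _ (+) (odd X (+) _)]count_conj (negPf (cr _)).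
Qed.

End Words.

(** * Length and inversions in a Coxeter system *)

Section Coxeter.
Variables (W : groupType) (S : set W).
Hypothesis hcox : coxeter_system S.
Implicit Types (u v a b : seq W) (x y s t w g : W).

Lemma gen_mul s : S s -> s * s = 1.
Proof.
by move=> Ss; have := elt_orderP (x := s); rewrite (coxeter_order2 hcox Ss); apply.
Qed.

Lemma genV s : S s -> s^-1 = s.
Proof. by move=> Ss; rewrite -[RHS](mulKg s) gen_mul // mulg1. Qed.

Lemma word_in_cat a b : word_in S (a ++ b) <-> word_in S a /\ word_in S b.
Proof.
split=> [h|[ha hb] x]; last by rewrite mem_cat => /orP[/ha|/hb].
by split=> x hx; apply: h; rewrite mem_cat hx ?orbT.
Qed.

Lemma word_in_cons s a : word_in S (s :: a) <-> S s /\ word_in S a.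
Proof.
rewrite -cat1s; split=> [/word_in_cat[h ha]|[h ha]].
  by split=> //; apply: h; rewrite inE.
by apply/word_in_cat; split=> // x; rewrite inE => /eqP ->.
Qed.

Lemma reduced_exists w : exists u, reduced_word S w u.
Proof.
have [v hv vw] := coxeter_generated hcox w.
have hm : [set size u | u in word_for S w] (size v) by exists v.
by have [[u hu us] _] := minimum_natP hm; exists u.
Qed.

Lemma cox_length_le w u : word_for S w u -> (cox_length S w <= size u)%N.
Proof.
move=> hu; have hm : [set size u | u in word_for S w] (size u) by exists u.
by have [_] := minimum_natP hm; apply.
Qed.

(** The presentation of the group enters here: insertions of relators preserve these parities, which
    thus depend only on the group element. *)
Lemma odd_refls u v x : word_in S u -> word_in S v ->
  word_prod u = word_prod v ->
  odd (count_mem x (refls u)) = odd (count_mem x (refls v)).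
Proof.
move=> hu hv /(coxeter_presentation hcox hu hv).
elim=> {hu hv}{u v} [u v|u|u v _ ->|u v z _ -> _ ->] //.
exact/count_refls_insert/gen_mul.
Qed.

Lemma refls_deletion u t : word_in S u -> t \in refls u ->
  exists v, [/\ word_in S v, (size u = (size v).+1)%N &
    word_prod u * t = word_prod v].
Proof.
elim: u => [//|s u IH] /word_in_cons[Ss hu]; rewrite /= inE.
case/orP=> [/eqP->|/(IH hu)[v [hv sv tv]]].
  by exists u; split => //; rewrite word_prod_cons -mulgA -conjgC mulgA gen_mul // mul1g.
exists (s :: v); split; rewrite /= ?sv //; first exact/word_in_cons.
by rewrite !word_prod_cons -mulgA tv.
Qed.

(** If the reflection of the first letter occurred again, deleting both letters would give a shorter
    word of the same value. *)
Lemma refls_uniq w u : reduced_word S w u -> uniq (refls u).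
Proof.
move=> [[+ <-]]; elim: u => [//|s u IH] /word_in_cons[Ss hu] su /=.
apply/andP; split.
  apply/negP => /(refls_deletion hu)[v [hv sv tv]].
  have : word_for S (word_prod (s :: u)) v.
    by split=> //; rewrite -tv -conjgC word_prod_cons.
  by move/cox_length_le; rewrite -su /= sv; lia.
apply: IH => //; apply/eqP; rewrite eqn_leq cox_length_le // andbT.
have [v [[hv vw] sv]] := reduced_exists (word_prod u).
have : word_for S (word_prod (s :: u)) (s :: v).
  by split; [apply/word_in_cons | rewrite !word_prod_cons vw].
by move/cox_length_le; rewrite -su -sv.
Qed.

(** For a word [v] of value [g], [rev v ++ v] has value 1, hence even counts. Inserting [s] in the
    middle adds one occurrence of [s ^ g] and, as [s] commutes with itself, keeps the others. *)
Lemma odd_refls_reflection s g : S s ->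
  exists u, [/\ word_in S u, word_prod u = s ^ g &
    odd (count_mem (s ^ g) (refls u))].
Proof.
move=> Ss; have [v hv vg] := coxeter_generated hcox g.
have rv : word_in S (rev v) /\ word_prod (rev v) = g^-1.
  split; first by move=> x; rewrite mem_rev => /hv.
  rewrite -vg; elim: v hv {vg} => [|x v IH] hv.
    by rewrite word_prod_nil invg1.
  case/word_in_cons: hv => Sx hv; rewrite rev_cons -cats1 word_prod_cat IH //.
  by rewrite !word_prod_cons word_prod_nil mulg1 invgM (genV Sx).
case: rv => hrv prv; exists (rev v ++ s :: v); split.
- by apply/word_in_cat; split=> //; apply/word_in_cons.
- by rewrite word_prod_cat word_prod_cons prv vg.
have : ~~ odd (count_mem (s ^ g) (refls (rev v ++ v))).
  rewrite (@odd_refls _ [::]) //; first by apply/word_in_cat.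
  by rewrite word_prod_cat prv vg mulVg word_prod_nil.
rewrite !refls_cat !count_cat !count_conj word_prod_cons /= !vg eqxx.
have -> : (s ^ g) ^ (s * g)^-1 = s.
  by rewrite invgM conjgM conjgK (genV Ss) /conjg mulKg.
by rewrite conjgK; lia.
Qed.

(** Deletion gives one direction. If [t] is not in [refls u], appending a word for [t] makes its
    count odd, so [t] is a reflection of any reduced word of [w * t], and deletion there shows that
    [w * t] is longer than [w]. *)
Lemma refls_length w u t : reduced_word S w u -> reflections S t ->
  (cox_length S (w * t) < cox_length S w)%N = (t \in refls u).
Proof.
move=> [[hu uw] su] [s Ss [g _ tE]]; have tt : t * t = 1.
  by rewrite -tE -conjMg gen_mul // conj1g.
have del w' u' : reduced_word S w' u' -> t \in refls u' ->
    (cox_length S (w' * t) < cox_length S w')%N.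
  move=> [[hu' uw'] su'] /(refls_deletion hu')[v [hv sv tv]].
  rewrite -su' sv ltnS; apply: cox_length_le; split => //.
  by rewrite -tv uw'.
apply/idP/idP => [lt|]; last exact: del.
apply: contraLR lt => tu; rewrite -leqNgt ltnW //.
have [v [[hv vw] sv]] := reduced_exists (w * t).
rewrite -[X in (cox_length S X < _)%N]mulg1 -tt mulgA; apply: (del _ v) => //.
have [z [hz zt cz]] := odd_refls_reflection g Ss; rewrite tE in zt cz.
suff : odd (count_mem t (refls v)).
  by apply: contraTT => /count_memPn ->.
rewrite (@odd_refls _ (u ++ z)) //.
- rewrite refls_cat count_cat count_conj zt oddD cz addbT.
  suff -> : t ^ t^-1 = t by rewrite (count_memPn tu).
  by rewrite /conjg invgK mulgA mulgK.
- by apply/word_in_cat.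
- by rewrite word_prod_cat uw zt vw.
Qed.

End Coxeter.

(** * The heap of a fully commutative element *)

Lemma uniq_map_inj (T1 T2 : eqType) (h : T1 -> T2) (r : seq T1) :
  uniq (map h r) -> {in r &, injective h}.
Proof.
elim: r => //= z r IH /andP[zr ur] x y; rewrite !inE.
move=> /predU1P[->|xr] /predU1P[->|yr] // hxy; last exact: IH.
- by rewrite hxy map_f in zr.
- by rewrite -hxy map_f in zr.
Qed.

(** * Moving a subword to the end of a word *)

Section TaggedWords.
Variables (W : groupType) (X : eqType) (f : X -> W).
Implicit Types (P : pred X) (L : seq X) (u : seq W).

Lemma commute_word x u : {in u, forall y, x * y = y * x} ->
  x * word_prod u = word_prod u * x.
Proof. by move=> h; rewrite /word_prod big_seq; apply: commute_prod. Qed.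

Definition separable P L :=
  pairwise (fun i j => [==> P i, ~~ P j => f i * f j == f j * f i]) L.

Lemma separable_commute P x L : separable P (x :: L) -> P x ->
  f x * word_prod [seq f i | i <- L & ~~ P i] =
  word_prod [seq f i | i <- L & ~~ P i] * f x.
Proof.
move=> /= /andP[/allP h _] Px; apply: commute_word => _ /mapP[y + ->].
by rewrite mem_filter => /andP[Py /h]; rewrite Px Py => /eqP.
Qed.

Lemma separable_prod P L : separable P L ->
  word_prod [seq f i | i <- L] =
  word_prod [seq f i | i <- L & ~~ P i] * word_prod [seq f i | i <- L & P i].
Proof.
elim: L => [|x L IH] /= hL; first by rewrite word_prod_nil mulg1.
have hL' : separable P L by case/andP: hL.
rewrite word_prod_cons IH //; case Px: (P x) => /=.
  by rewrite word_prod_cons !mulgA separable_commute.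
by rewrite word_prod_cons mulgA.
Qed.

Fixpoint tagged_refls L : seq (X * W) :=
  if L is x :: L' then
    (x, f x ^ word_prod [seq f i | i <- L']) :: tagged_refls L'
  else [::].

Lemma tagged_refls_fst L : [seq p.1 | p <- tagged_refls L] = L.
Proof. by elim: L => //= x L ->. Qed.

Lemma tagged_refls_snd L :
  [seq p.2 | p <- tagged_refls L] = refls [seq f i | i <- L].
Proof. by elim: L => //= x L ->. Qed.

(** The dropped letters that follow a kept letter [x] can be moved next to it; they commute with
    [f x], so its reflection is unchanged. *)
Lemma tagged_refls_filter P L : separable P L ->
  tagged_refls [seq i <- L | P i] = [seq p <- tagged_refls L | P p.1].
Proof.
elim: L => //= x L IH hL; have hL' : separable P L by case/andP: hL.
case Px: (P x) => /=; last exact: IH.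
rewrite IH // (separable_prod hL') conjgM; congr ((_, _ ^ _) :: _).
by rewrite /conjg separable_commute ?mulKg.
Qed.

Lemma refls_filter P L x t : separable P L ->
    uniq (refls [seq f i | i <- L]) -> (x, t) \in tagged_refls L ->
  (t \in refls [seq f i | i <- L & P i]) = P x.
Proof.
move=> hL; rewrite -tagged_refls_snd => uL xt.
rewrite -tagged_refls_snd tagged_refls_filter //.
apply/mapP/idP => [[p + tp]|Px]; last by exists (x, t); rewrite // mem_filter Px.
rewrite mem_filter => /andP[Pp pL].
by move: Pp; rewrite -(uniq_map_inj uL xt pL tp).
Qed.

End TaggedWords.

(** * Commutation classes and the weak interval *)

Section FullyCommutative.
Variables (W : groupType) (S : set W) (w : W).
Hypotheses (hcox : coxeter_system S) (hfc : fully_commutative S w).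
Implicit Types (u v a b : seq W) (x y s t g : W).

Local Notation edge := (diagram_edge S).

Lemma elt_order_conj x g : elt_order (x ^ g) = elt_order x.
Proof.
rewrite /elt_order; congr (minimum _ _); apply/seteqP.
by split=> n /= [n0 /eqP]; rewrite -?conjXg ?conjg_eq1 => /eqP xn;
  rewrite -?conjXg ?xn ?conj1g.
Qed.

Lemma diagram_edge_sym : symmetric edge.
Proof.
move=> s t; suff h x y : edge x y -> edge y x by apply/idP/idP; apply: h.
move=> /asboolP[Sx Sy nxy o]; apply/asboolP; split=> //; first exact: nesym.
by rewrite (_ : y * x = (x * y) ^ x) ?elt_order_conj // /conjg !mulgA mulVg mul1g.
Qed.

Lemma diagram_edge_irr : irreflexive edge.
Proof. by move=> s; apply/negbTE/negP => /asboolP[_ _ /(_ erefl)]. Qed.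

Lemma unlinked_commute s t : S s -> S t -> ~~ linked edge s t -> s * t = t * s.
Proof.
move=> Ss St; rewrite negb_or => /andP[/eqP nst /negP ne].
have [o0 o3] : elt_order (s * t) <> 0%N /\ ~ (3 <= elt_order (s * t))%N.
  by split=> o; apply: ne; apply/asboolP; split=> //; [left | right].
have := elt_orderP (x := s * t).
case: (elt_order (s * t)) o0 o3 => [//|[_ _ /(_ isT) st1|[_ _ /(_ isT)|//]]].
  by case: nst; rewrite -(genV hcox St); apply/eqP; rewrite -mulg_eq1; apply/eqP.
move=> st2; have : (s * t)^-1 = s * t by apply: mulg1_eq.
by rewrite invgM (genV hcox Ss) (genV hcox St).
Qed.

(** The two letters exchanged by a move are neither equal nor adjacent in the diagram, so they
    cannot both belong to the linked pair [p], [q]. *)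
Lemma filter_commutation u v p q : S p -> S q -> linked edge p q ->
  clos_refl_sym_trans _ (@commutation_move W) u v ->
  filter [in [:: p; q]] u = filter [in [:: p; q]] v.
Proof.
move=> Sp Sq pq; elim=> [{}u {}v|//|{}u {}v _ ->//|{}u {}v z _ -> _ -> //].
move=> [a [b [s [t [o2 -> ->]]]]]; rewrite !filter_cat /=.
have o1 : elt_order (1 : W) <> 2%N.
  by have := @elt_order_gt0 W 1 1 isT (expg1n _ _); case: elt_order => [|[|]].
case sI: (s \in _); case tI: (t \in _) => //; exfalso.
have [st|/eqP nst] := eqVneq s t.
  have St : S t by move: tI; rewrite !inE => /orP[]/eqP ->.
  by move: o2; rewrite st (gen_mul hcox).
have nst' : (s == t) = false by apply/eqP.
have nts' : (t == s) = false by rewrite eq_sym.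
have : edge s t.
  have [ps|nps] := eqVneq s p; last first.
    move: sI tI; rewrite !inE (negPf nps) /= => /eqP sq.
    rewrite -sq nts' orbF => /eqP tp.
    by move: pq; rewrite /linked -sq -tp nts' diagram_edge_sym => /asboolP.
  move: tI; rewrite !inE -ps nts' /= => /eqP tq.
  by move: pq; rewrite /linked -ps -tq nst' => /asboolP.
by move=> /asboolP[_ _ _]; rewrite o2 => -[].
Qed.

Lemma reduced_suffix x a b : reduced_word S x (a ++ b) ->
  reduced_word S (word_prod b) b.
Proof.
move=> [[/word_in_cat[ha hb] abx] sab]; split=> //; apply/eqP.
rewrite eqn_leq cox_length_le // andbT.
have [v [[hv vb] sv]] := reduced_exists hcox (word_prod b).
have : word_for S x (a ++ v).
  by split; [apply/word_in_cat | rewrite word_prod_cat vb -word_prod_cat].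
by move/cox_length_le; rewrite -sab -sv !size_cat leq_add2l.
Qed.

Lemma reduced_suffix_le x a b : reduced_word S x (a ++ b) ->
  left_weak_le S (word_prod b) x.
Proof.
elim: a x => [|s a IH] x h; first by case: h => [[_ <-] _]; apply: rt_refl.
have h' := @reduced_suffix x [:: s] _ h.
apply: rt_trans (IH _ h') (rt_step _ _ _ _ _).
case: h h' => [[/word_in_cons[Ss _] <-] /= sx] [_ sy].
by exists s => //; rewrite -sx -sy -word_prod_cons.
Qed.

Section Heap.
Variable om : seq W.
Hypothesis hom : reduced_word S w om.

Let n := size om.
Let f (i : 'I_n) : W := tnth (in_tuple om) i.
Local Notation heap_upset := (upset f edge (@nat_of_ord n)).

Definition upset_word (I : {set 'I_n}) := [seq f i | i <- enum 'I_n & i \in I].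
Definition upset_elt I := word_prod (upset_word I).

Lemma map_heap : [seq f i | i <- enum 'I_n] = om.
Proof. exact: map_tnth_enum. Qed.

Lemma heap_gen i : S (f i).
Proof. by case: hom => [[h _] _]; apply: h; apply: mem_tnth. Qed.

Lemma pairwise_enum : pairwise (fun i j : 'I_n => (i < j)%N) (enum 'I_n).
Proof.
have := iota_ltn_sorted 0 n; rewrite sorted_pairwise; last exact: ltn_trans.
by rewrite -val_enum_ord pairwise_map.
Qed.

Lemma upset_separable I : I \in heap_upset ->
  separable f [in I] (enum 'I_n).
Proof.
move=> /upsetP hI; apply: sub_pairwise pairwise_enum => i j ij /=.
apply/implyP => iI; apply/implyP => jI; apply/eqP.
apply: unlinked_commute; try exact: heap_gen.
by apply: contra jI => l; apply: hI iI ij l.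
Qed.

(** Moving the letters of [I] to the end of [om] changes neither its value nor its length. *)
Lemma upset_reduced I : I \in heap_upset ->
  reduced_word S w ([seq f i | i <- enum 'I_n & i \notin I] ++ upset_word I).
Proof.
move=> hI; have sep := upset_separable hI.
case: hom => [[_ omw] som]; split; first split.
- apply/word_in_cat; split=> _ /mapP[i _ ->]; exact: heap_gen.
- by rewrite word_prod_cat -separable_prod // map_heap.
- rewrite size_cat !size_map !size_filter addnC.
  by rewrite (count_predC [in I]) size_enum_ord.
Qed.

Lemma upset_word_reduced I : I \in heap_upset ->
  reduced_word S (upset_elt I) (upset_word I).
Proof. by move/upset_reduced/reduced_suffix. Qed.

Lemma upset_elt_interval I : I \in heap_upset ->
  weak_interval S w (upset_elt I).
Proof.
move=> hI; split; last exact: reduced_suffix_le (upset_reduced hI).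
have := upset_word_reduced hI; rewrite -[upset_word I]cats0.
by move/reduced_suffix_le; rewrite word_prod_nil.
Qed.

(** Full commutativity is given for [w] only: a common prefix extends both words to reduced words of
    [w], whose projections agree, and then cancels. *)
Lemma upset_word_filter I v p q : I \in heap_upset ->
    reduced_word S (upset_elt I) v -> S p -> S q -> linked edge p q ->
  filter [in [:: p; q]] (upset_word I) = filter [in [:: p; q]] v.
Proof.
move=> hI [[hv vI] sv] Sp Sq pq.
have hr := upset_reduced hI; have [_ sI] := upset_word_reduced hI.
set a := (X in X ++ _) in hr.
have hr' : reduced_word S w (a ++ v).
  case: hr => -[/word_in_cat[ha _] pw] sw; split; first split.
  - exact/word_in_cat.
  - by rewrite -pw !word_prod_cat vI.
  - by rewrite -sw !size_cat sI sv.
have := filter_commutation Sp Sq pq (hfc hr hr').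
by rewrite !filter_cat => /eqP; rewrite eqseq_cat // eqxx => /eqP.
Qed.

(* If [s] is a left descent of the element of an upset, then full commutativity
   forces the first letter [s] of its word to precede every letter that does
   not commute with [s], so that this letter can be removed. *)
Lemma upset_elt_cover I (v : W) : I \in heap_upset ->
  weak_cover S v (upset_elt I) -> exists2 J, J \in heap_upset & v = upset_elt J.
Proof.
move=> hI [s Ss [uE lE]]; have [b [[hb bv] sb]] := reduced_exists hcox v.
have red : reduced_word S (upset_elt I) (s :: b).
  split; last by rewrite /= sb lE.
  by split; [apply/word_in_cons | rewrite word_prod_cons bv].
have filterE p : S p -> linked edge p s -> exists r,
    filter [in [:: p; s]] (upset_word I) = s :: r.
  move=> Sp ps; rewrite (upset_word_filter hI red Sp Ss ps) /= !inE eqxx orbT.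
  by eexists.
pose L := [seq i <- enum 'I_n | i \in I].
have hasL : has (fun i => f i == s) L.
  have [|r rE] := filterE s Ss; first by rewrite /linked eqxx.
  have : s \in filter [in [:: s; s]] (upset_word I) by rewrite rE mem_head.
  rewrite mem_filter => /andP[_ /mapP[i iL ->]].
  by apply/hasP; exists i.
have uL : uniq L by rewrite filter_uniq // enum_uniq.
have pL : pairwise (fun i j : 'I_n => (i < j)%N) L.
  by apply: pairwise_filter; apply: pairwise_enum.
have memL i : (i \in L) = (i \in I) by rewrite mem_filter mem_enum andbT.
have [x [p1 [p2 [LE /eqP fx np1]]]] : exists (x : 'I_n) (p1 p2 : seq 'I_n),
    [/\ L = p1 ++ x :: p2, f x == s & ~~ has (fun i => f i == s) p1].
  case: (split_find hasL) => x p1 p2 fx np1.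
  by exists x, p1, p2; rewrite -cat_rcons.
(* The projection to [f i] and [s] starts with [s], whereas a linked letter before [x], the first
   letter [s], would make it start otherwise. *)
have p1s i : i \in p1 -> ~~ linked edge (f i) s.
  move=> ip1; apply/negP => l; have [r] := filterE _ (heap_gen i) l.
  rewrite /upset_word -/L LE map_cat filter_cat.
  have : f i \in filter [in [:: f i; s]] [seq f i | i <- p1].
    by rewrite mem_filter map_f // !inE eqxx.
  case E: (filter _ _) => [//|c c'] _ [cs _].
  have : c \in filter [in [:: f i; s]] [seq f i | i <- p1] by rewrite E mem_head.
  rewrite cs mem_filter => /andP[_ /mapP[j jp1 sj]].
  by move/negP: np1; apply; apply/hasP; exists j; rewrite // -sj.
have xI : x \in I by rewrite -memL LE mem_cat mem_head orbT.
exists (I :\ x)%SET.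
  apply/upsetP => i j; rewrite !finset.in_setD1 => /andP[ix iI] ij l.
  rewrite (upsetP _ _ _ _ hI i) // andbT; apply: contraTneq l => jx.
  rewrite jx fx; apply: p1s; move: iI; rewrite -memL LE mem_cat in_cons.
  rewrite (negPf ix) /= => /orP[//|ip2]; move: pL.
  rewrite LE pairwise_cat pairwise_cons => /and3P[_ _ /andP[/allP/(_ i ip2)]].
  by move: ij; rewrite jx; lia.
have wordJ : [seq i <- enum 'I_n | i \in (I :\ x)%SET] = p1 ++ p2.
  have xp : x \notin p1 ++ p2.
    by move: uL; rewrite LE -[x :: p2]cat1s uniq_catCA => /andP[].
  have -> : p1 ++ p2 = filter (predC1 x) L.
    rewrite LE filter_cat /= eqxx -filter_cat; apply/esym/all_filterP/allP => i.
    by apply: contraTneq => ->.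
  by rewrite /L -[RHS]filter_predI; apply: eq_filter => i; rewrite /= finset.in_setD1.
have vE : v = s * upset_elt I by rewrite uE mulgA (gen_mul hcox Ss) mul1g.
rewrite vE /upset_elt /upset_word wordJ -/L LE !map_cat !word_prod_cat /=.
rewrite word_prod_cons fx mulgA commute_word; last first.
  move=> _ /mapP[i ip1 ->]; apply: esym.
  by apply: unlinked_commute (p1s i ip1) => //; apply: heap_gen.
by rewrite -!mulgA (mulgA s) (gen_mul hcox Ss) mul1g.
Qed.

(** The whole heap has value [w], and [upset_elt_cover] keeps every descent from [w] among the
    values of upsets. *)
Lemma weak_interval_upset :
  weak_interval S w = [set upset_elt I | I in [set` heap_upset]].
Proof.
apply/seteqP; split=> [u [_ uw]|_ [I hI <-]]; last exact: upset_elt_interval.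
have wI : [set upset_elt I | I in [set` heap_upset]] w.
  exists [set: 'I_n]%SET.
    by apply/upsetP => i j _ _ _; rewrite finset.in_setT.
  rewrite /upset_elt /upset_word (eq_filter (a2 := predT)) ?filter_predT.
    by rewrite map_heap; case: hom => -[].
  by move=> i; rewrite /= finset.in_setT.
elim: uw wI => [x y xy [I hI yI]|//|x y z _ IH1 _ IH2 /IH2/IH1 //].
by rewrite -yI in xy; have [J hJ ->] := upset_elt_cover hI xy; exists J.
Qed.

(** [t] is the reflection of the letter [i] in [om]; passing to the subword of an upset containing
    [i] does not change it, so one [t] serves all [I]. *)
Lemma heap_reflection i : exists2 t, reflections S t &
  forall I, I \in heap_upset ->
    (cox_length S (upset_elt I * t) < cox_length S (upset_elt I))%N = (i \in I).
Proof.
have : i \in [seq p.1 | p <- tagged_refls f (enum 'I_n)].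
  by rewrite tagged_refls_fst mem_enum.
case/mapP => -[j t] hi /= ij; rewrite -{j}ij in hi.
have ht : reflections S t.
  elim: (enum _) hi => [//|j L IH] /=; rewrite in_cons => /predU1P[[_ ->]|/IH //].
  by exists (f j); [exact: heap_gen | eexists].
exists t => // I hI; rewrite (refls_length hcox (upset_word_reduced hI) ht).
apply: refls_filter hi; first exact: upset_separable.
by rewrite map_heap; apply: (refls_uniq hcox hom).
Qed.

Lemma upset_elt_inj : {in heap_upset &, injective upset_elt}.
Proof.
move=> I J hI hJ IJ; apply/setP => i; have [t _ ht] := heap_reflection i.
by rewrite -!ht // IJ.
Qed.

Lemma heap_separated (i j : 'I_n) : (i < j)%N -> f i = f j ->
  exists2 k : 'I_n, (i < k < j)%N & edge (f i) (f k).
Proof.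
move=> ij fij; apply: contrapT => no.
have iE : i \in enum 'I_n by rewrite mem_enum.
have jE : j \in enum 'I_n by rewrite mem_enum.
move: map_heap pairwise_enum iE jE; move: (enum 'I_n) => E + + iE.
case/splitPr: iE => p1 p2 pE; rewrite pairwise_cat pairwise_cons.
case/and3P=> /allrelP h1 _ /andP[/allP h2 h3]; rewrite mem_cat in_cons => jp.
have jp2 : j \in p2.
  case/or3P: jp => // [jp1|/eqP ji]; last by rewrite ji ltnn in ij.
  by have := h1 j i jp1 (mem_head _ _); lia.
case/splitPr: jp2 h2 h3 pE {h1 jp} => p3 p4 h2.
rewrite pairwise_cat => /and3P[/allrelP h3 _ _] pE.
(* Letters between [i] and [j] that equal [f i] commute with it as well, so [f i] can be moved next
   to [f j] and cancelled, which shortens [om]. *)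
have cmm : f i * word_prod [seq f k | k <- p3] = word_prod [seq f k | k <- p3] * f i.
  apply: commute_word => _ /mapP[k kp3 ->]; have [->//|nik] := eqVneq (f i) (f k).
  apply: unlinked_commute; try exact: heap_gen.
  rewrite /linked (negPf nik) /=; apply/negP => ek; apply: no; exists k => //.
  by rewrite h2 ?mem_cat ?kp3 // (h3 k j kp3) ?mem_head.
case: hom => -[hin hw hs].
have := @cox_length_le _ S w [seq f k | k <- p1 ++ p3 ++ p4].
rewrite -hs -pE !size_map !size_cat /= size_cat /= => H.
suff : (size p1 + (size p3 + size p4) < size p1 + (size p3 + (size p4).+1).+1)%N /\
 (size p1 + (size p3 + (size p4).+1).+1 <= size p1 + (size p3 + size p4))%N by lia.
split; first by lia.
apply: H; split; first by move=> _ /mapP[k _ ->]; exact: heap_gen.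
rewrite -hw -pE !map_cat /= !map_cat /= !word_prod_cat !word_prod_cons.
rewrite word_prod_cat word_prod_cons -fij; congr (_ * _).
by rewrite !mulgA cmm -(mulgA _ (f i) (f i)) (gen_mul hcox (heap_gen i)) mulg1.
Qed.

End Heap.
End FullyCommutative.

(** * Counting and the balance constant *)

Lemma card_fset_set_imset (X : finType) (T : choiceType) (g : X -> T) (P : {set X}) :
  {in P &, injective g} -> #|` fset_set [set g x | x in [set` P]]| = #|P|.
Proof.
move=> g_inj; have finP : finite_set [set` P] := finite_finpred P.
have memP x : (x \in fset_set [set` P]) = (x \in P).
  by rewrite (in_fset_set finP) mem_setE.
rewrite fset_set_image // card_in_imfset /=; last first.
  by move=> x y; rewrite !memP; apply: g_inj.
rewrite cardE; apply/perm_size/uniq_perm; rewrite ?enum_uniq ?fset_uniq //.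
by move=> x; rewrite mem_enum memP.
Qed.

(** Finitely many candidate values ensure a greatest element, so [maximum] does not fall back on its
    default. *)
Lemma le_maximum_finite (m : nat) (F : 'I_m -> rat) (A : set rat) (x : rat) :
  (forall y, A y -> exists i, y = F i) -> A x -> (x <= maximum 0%R A)%R.
Proof.
move=> AF Ax; have [i0 xE] := AF x Ax.
pose P i := `[< A (F i) >].
have Pi0 : P i0 by apply/asboolP; rewrite -xE.
case: (@Order.TotalTheory.arg_maxP _ _ _ i0 P F Pi0) => i /asboolP Ai imax.
rewrite /maximum; case: xgetP => [_ -> [_ /(_ x Ax)] //|no].
case: (no (F i)); split=> // y Ay; have [j yj] := AF y Ay.
by rewrite yj; apply: imax; apply/asboolP; rewrite -yj.
Qed.

Theorem theorem3p4 (W : groupType) (S : set W) (w : W)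
  (hcox : coxeter_system S)
  (hacyc : acyclic_diagram S)
  (hw : w <> 1%g)
  (hfc : fully_commutative S w) :
  (1 / 3 <= balance_constant S (weak_interval S w))%R.
Proof.
have [om hom] := reduced_exists hcox w.
set n := size om.
have n0 : (0 < n)%N.
  rewrite lt0n size_eq0; apply/eqP => om0; apply: hw.
  by case: hom => -[_ <-] _; rewrite om0 word_prod_nil.
pose f (i : 'I_n) : W := tnth (in_tuple om) i.
pose U := upset f (diagram_edge S) (@nat_of_ord n).
have [i /andP[le1 le2]] := @balanced_element _ _ f (diagram_edge S)
  (@diagram_edge_sym W S) (@diagram_edge_irr W S) (@nat_of_ord n)
  (Ordinal n0) (@ord_inj n) (heap_separated hcox hom) hacyc.
rewrite -/U in le1 le2.
have [t tS ht] := heap_reflection hcox hom i.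
have CE := weak_interval_upset hcox hfc hom.
have injU := upset_elt_inj hcox hom.
set C := weak_interval S w.
have cC : #|` fset_set C| = #|U| by rewrite /C CE card_fset_set_imset.
have cCt : #|` fset_set (inversion_part S C t)|
    = #|upsets_with f (diagram_edge S) (@nat_of_ord n) i|.
  rewrite -(@card_fset_set_imset _ _ (@upset_elt _ om)); last first.
    by move=> I J; rewrite !upsets_withE => /andP[hI _] /andP[hJ _]; apply: injU.
  congr #|` fset_set _|; apply/seteqP; rewrite /inversion_part /C CE.
  split=> [_ [[I hI <-]] /=|_ [I /= + <-]] /=.
    by rewrite ht // => iI; exists I; rewrite //= upsets_withE iI andbT.
  by rewrite upsets_withE => /andP[hI iI]; split; [exists I | rewrite ht].
have finC : finite_set C.
  by rewrite /C CE; apply: finite_image; apply: finite_finpred.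
have U0 : (0 < #|U|)%N.
  by apply/card_gt0P; exists [set: 'I_n]%SET; apply/upsetP => ? ? *; rewrite finset.in_setT.
(* An inversion part has between 0 and [#|U|] elements, hence the successor in the index type. *)
pose F (k : 'I_(#|U|.+1)) : rat := 
  Order.min (k%:R / #|U|%:R)%R (1 - k%:R / #|U|%:R)%R.
apply: (@le_trans _ _ (Order.min (inversion_ratio S C t) (1 - inversion_ratio S C t)%R)).
  rewrite /inversion_ratio cC cCt; set a := #|upsets_with _ _ _ _| in le1 le2 *.
  have N0 : (0 < #|U|%:R :> rat)%R by rewrite ltr0n.
  have h1 : (1 / 3 <= a%:R / #|U|%:R :> rat)%R.
    rewrite ler_pdivlMr // mulrAC mul1r ler_pdivrMr // -natrM ler_nat.
    by rewrite mulnC.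
  have h2 : (a%:R / #|U|%:R <= 2 / 3 :> rat)%R.
    rewrite ler_pdivrMr // mulrAC ler_pdivlMr // -!natrM ler_nat.
    by rewrite mulnC.
  by rewrite le_min h1; lra.
apply: (@le_maximum_finite _ F) => [_ [t' _ <-]|]; last by exists t.
have leC : (#|` fset_set (inversion_part S C t')| < #|U|.+1)%N.
  rewrite ltnS -cC; apply: fsubset_leq_card.
  rewrite -fset_set_sub //; first by move=> u [].
  by apply: sub_finite_set finC => u [].
by exists (Ordinal leC); rewrite /F /inversion_ratio cC.
Qed.
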